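(* Let $(R_n)_{n\ge1}$ be a sequence of generalized Oppenheim random variables with associated distribution function $F$ (as in the context), and let $M_n=\max_{1\le k\le n}R_k$, $Z_n=\min_{1\le k\le n}R_k$. Assume that $1<x<y$, that there exists $\beta>0$ such that $F(s)-F(t)\le\beta(s-t)$ for all $s\ge t$, and that $F\left(\frac1x\right)<\frac12$. Then $$\lim_{n\to\infty}\left\{P(Z_n>x,\,M_n\le y)-P(Z_n>x)P(M_n\le y)\right\}=0.$$
   Context: Generalized Oppenheim random variables. Let $\Omega=[0,1]$ with its Borel $\sigma$-algebra and let $P$ be Lebesgue measure; $\mathbb N^*=\{1,2,\dots\}$. Let $F$ be a (not necessarily continuous) probability distribution function with $\lim_{t\to0^+}F(t)=0$ and $\lim_{t\to1^-}F(t)\le1$, with $F(x)=0$ for $x\le0$ and $F(x)=1$ for $x\ge1$. Let $\varphi_n:\mathbb N^*\to\mathbb R^+$, $n\ge1$, be functions with $\varphi_n\ge1$, and let $q_n=q_n(h_1,\dots,h_n)\ge0$ be nonnegative numbers (possibly depending on the integers $h_1,\dots,h_n$). Put $\delta_j(h,k,q)=\frac{\varphi_j(h)(1+q)}{k+\varphi_j(h)q}$. Let $(B_n)_{n\ge1}$ be random variables on $\Omega$ with values in $\mathbb N^*$ such that, for all $n\ge 1$ and all positive integers with $h_1\ge1$ and $h_j\ge\varphi_{j-1}(h_{j-1})$, $j=2,\dots,n$, $$P(B_{n+1}=h_{n+1}\mid B_n=h_n,\dots,B_1=h_1)=F(\delta_n(h_n,h_{n+1},q_n))-F(\delta_n(h_n,h_{n+1}+1,q_n)).$$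 Let $Q_n=q_n(B_1,\dots,B_n)$ and $$R_n=\frac{B_{n+1}+\varphi_n(B_n)Q_n}{\varphi_n(B_n)(1+Q_n)}=\frac1{\delta_n(B_n,B_{n+1},Q_n)}.$$ One has $R_n\ge1$, i.e. $B_{n+1}\ge\varphi_n(B_n)$, for every $n$. *)

(* Defs.v *)
From HB Require Import structures.
From mathcomp Require Import all_boot all_order all_algebra.
From mathcomp Require Import all_classical all_reals all_analysis.

Set Implicit Arguments.
Unset Strict Implicit.
Unset Printing Implicit Defensive.
Import Order.TTheory GRing.Theory Num.Theory.
Import numFieldNormedType.Exports.

Local Open Scope classical_set_scope.
Local Open Scope ring_scope.

Definition unit_interval (R : realType) : Type := set_type `[0 : R, 1 : R]%classic.

Section unit_interval_instances.
Context {R : realType}.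

HB.instance Definition _ :=
  Choice.copy (unit_interval R) (set_type `[0 : R, 1 : R]%classic).

Lemma unit_interval0 : (0 : R) \in `[0 : R, 1 : R]%classic.
Proof. by rewrite inE /= in_itv /= lexx ler01. Qed.

HB.instance Definition _ := isPointed.Build (unit_interval R)
  (exist _ (0 : R) unit_interval0).

Definition unit_val : unit_interval R -> R := @set_val R `[0 : R, 1 : R]%classic.

Lemma unit_val_inj : injective unit_val.
Proof. exact: val_inj. Qed.

Lemma image_unit_val_preimage (B : set R) :
  unit_val @` (unit_val @^-1` B) = `[0 : R, 1 : R]%classic `&` B.
Proof.
apply/seteqP; split => [_ [w /= Bw <-]|r [r01 Br]].
  split; last by [].
  exact: (set_valP w).
by exists (exist _ r (mem_set r01)).
Qed.

End unit_interval_instances.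

(* Omega = [0, 1] with the trace of the Borel sigma-algebra of R *)
Notation Omega R := (g_sigma_algebra_preimageType (@unit_val R)).

Definition lebP (R : realType) (A : set (Omega R)) : \bar R :=
  lebesgue_measure (unit_val @` A).

Section lebP_probability.
Context {R : realType}.
Local Open Scope ereal_scope.

Lemma measurable_unit_val_image (A : set (Omega R)) :
  measurable A -> measurable (unit_val @` A).
Proof.
case=> B mB <-; rewrite setTI image_unit_val_preimage.
exact: measurableI.
Qed.

Let lebP0 : lebP (set0 : set (Omega R)) = 0.
Proof. by rewrite /lebP image_set0 measure0. Qed.

Let lebP_ge0 (A : set (Omega R)) : 0 <= lebP A.
Proof. exact: measure_ge0. Qed.

Let lebP_semi_sigma_additive : semi_sigma_additive (@lebP R).
Proof.
move=> A mA tA mUA; rewrite /lebP image_bigcup.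
apply: measure_semi_sigma_additive.
- by move=> i; exact: measurable_unit_val_image.
- apply/trivIsetP => i j _ _ ij; apply/seteqP; split => // r [[u Aiu <-]].
  move=> [v Ajv /unit_val_inj vu]; rewrite vu in Ajv.
  have A0 : A i `&` A j = set0.
    by move/trivIsetP : tA => /(_ i j Logic.I Logic.I ij).
  by have : (A i `&` A j) u by []; rewrite A0.
- by rewrite -image_bigcup; exact: measurable_unit_val_image.
Qed.

HB.instance Definition _ := isMeasure.Build _ _ _ (@lebP R)
  lebP0 lebP_ge0 lebP_semi_sigma_additive.

Let lebP_setT : lebP [set: Omega R] = 1.
Proof.
rewrite /lebP -(preimage_setT (@unit_val R)) image_unit_val_preimage setIT.
by rewrite lebesgue_measure_itv /= lte_fin ltr01 oppr0 adde0.
Qed.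

HB.instance Definition _ :=
  Measure_isProbability.Build _ _ _ (@lebP R) lebP_setT.

End lebP_probability.

(* Real-valued probability *)
Definition Pr (R : realType) (A : set (Omega R)) : R := fine (lebP A).

(* Meaningful only when Pr C != 0 *)
Definition condPr (R : realType) (A C : set (Omega R)) : R :=
  Pr (A `&` C) / Pr C.

(* All sequences are indexed from 1, as phi_n, q_n, B_n, R_n with n >= 1: the
   values at index 0 are unused. Likewise N^* is the set of n : nat such that
   0 < n, and phi, q are constrained on positive integers only. *)

Section oppenheim.
Context {R : realType}.
Variables (F : R -> R) (phi : nat -> nat -> R).
Variables (q : forall n : nat, n.-tuple nat -> R).
Variable B : nat -> {RV (@lebP R) >-> nat}.

Definition delta (j h k : nat) (p : R) : R :=
  phi j h * (1 + p) / (k%:R + phi j h * p).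

Definition prefix1 (n : nat) (h : nat -> nat) : n.-tuple nat :=
  [tuple h i.+1 | i < n].

Definition admissible (n : nat) (h : nat -> nat) : Prop :=
  (1 <= h 1)%N /\
  forall j : nat, (2 <= j <= n)%N -> phi j.-1 (h j.-1) <= (h j)%:R.

Definition history (n : nat) (h : nat -> nat) : set (Omega R) :=
  [set w | forall j : nat, (1 <= j <= n)%N -> B j w = h j].

Record generalized_oppenheim : Prop := {
  oppenheim_F_right0 : F t @[t --> 0^'+] --> (0 : R) ;
  oppenheim_F_left1 : exists2 l : R, F t @[t --> 1^'-] --> l & l <= 1 ;
  oppenheim_F0 : forall t : R, t <= 0 -> F t = 0 ;
  oppenheim_F1 : forall t : R, 1 <= t -> F t = 1 ;
  oppenheim_phi_ge1 : forall n h : nat, (0 < n)%N -> (0 < h)%N -> 1 <= phi n h ;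
  oppenheim_q_ge0 : forall n (t : n.-tuple nat), (0 < n)%N ->
    all (leq 1) t -> 0 <= q t ;
  oppenheim_B_gt0 : forall n (w : Omega R), (0 < n)%N -> (0 < B n w)%N ;
  oppenheim_law : forall (n : nat) (h : nat -> nat), (0 < n)%N ->
    (forall j : nat, (1 <= j <= n.+1)%N -> (0 < h j)%N) ->
    admissible n h ->
    Pr (history n h) != 0 ->
    condPr [set w | B n.+1 w = h n.+1] (history n h) =
      F (delta n (h n) (h n.+1) (q (prefix1 n h))) -
      F (delta n (h n) (h n.+1).+1 (q (prefix1 n h))) }.

Definition oppenheim_Q (n : nat) (w : Omega R) : R :=
  q (prefix1 n (fun j => B j w)).

Definition oppenheim_R (n : nat) (w : Omega R) : R :=
  ((B n.+1 w)%:R + phi n (B n w) * oppenheim_Q n w) /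
  (phi n (B n w) * (1 + oppenheim_Q n w)).

(* For n >= 1 the default value R_1 is one of the terms *)
Definition oppenheim_max (n : nat) (w : Omega R) : R :=
  \big[Num.max/oppenheim_R 1 w]_(1 <= k < n.+1) oppenheim_R k w.

Definition oppenheim_min (n : nat) (w : Omega R) : R :=
  \big[Num.min/oppenheim_R 1 w]_(1 <= k < n.+1) oppenheim_R k w.

End oppenheim.

(* Main.v *)
Require Import Defs.
From HB Require Import structures.
From mathcomp Require Import all_boot all_order all_algebra.
From mathcomp Require Import all_classical all_reals all_analysis.
From mathcomp Require Import lra.
Import Order.TTheory GRing.Theory Num.Theory.
Import numFieldNormedType.Exports.
Local Open Scope classical_set_scope.
Local Open Scope ring_scope.

(** The difference tends to 0 because each of its two terms does: both
    P(Z_n > x, M_n <= y) and P(Z_n > x) P(M_n <= y) lie between 0 and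
    P(Z_n > x), and P(Z_n > x) <= F(1/x)^n with F(1/x) < 1/2.

    The geometric bound is an induction on n ([Pr_all_exceedS]): given a past
    B_1, ..., B_{n+1} along which R_1, ..., R_n exceed x, the event R_{n+1} > x
    has probability at most F(1/x).
    Indeed the conditional law telescopes, so that B_{n+1} >= m has conditional
    probability F(delta_n(B_n, m, Q_n)) for m >= 1 ([Pr_history_tail]).  Since
    R_n = 1/delta_n(B_n, B_{n+1}, Q_n), the event R_n > x forces B_{n+1} >= m for
    the least positive m with delta_n(B_n, m, Q_n) < 1/x, and monotonicity of F
    then gives the bound F(1/x).

    The conditional law is prescribed along admissible histories only, that is
    when B_j >= phi_{j-1}(B_{j-1}).  This is harmless: on the event that
    R_1, ..., R_n exceed x > 1 the history up to B_{n+1} is admissible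
    ([admissible_all_exceed]), and no other history contributes.

    The past is discrete, so conditioning on it amounts to summing over the
    countably many histories.  For that purpose a history is encoded as one
    natural number ([history_code]); every event that depends on finitely many
    B_j is a union of fibers of this code, which also gives its
    measurability. *)

(** * Fibers of a nat-valued function *)

Lemma measurable_preimage_nat d (T : measurableType d) (X : T -> nat)
    (S : set nat) :
  (forall i, measurable (X @^-1` [set i])) -> measurable (X @^-1` S).
Proof.
move=> mX; rewrite [X in measurable X](_ : _ =
    \bigcup_(i in S) X @^-1` [set i]); last first.
  apply/seteqP; split => [w Sw|w [i Si /= ->] //].
  by exists (X w).
by apply: bigcup_measurable => i _; exact: mX.
Qed.

Lemma measure_sum_fibers d (T : measurableType d) (R : realType)
    (mu : {measure set T -> \bar R}) (X : T -> nat) (A : set T) :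
  (forall i, measurable (X @^-1` [set i])) -> measurable A ->
  mu A = (\sum_(0 <= i <oo) mu (A `&` X @^-1` [set i]))%E.
Proof.
move=> mX mA; rewrite -measure_semi_bigcup.
- congr (mu _); apply/seteqP; split => [w Aw|w [i _ []] //].
  by exists (X w).
- by move=> i; apply: measurableI.
- apply/trivIsetP => i j _ _ /eqP ij; apply/seteqP; split => // w.
  by case=> -[_ /= wi] [_ /= wj]; case: ij; rewrite -wi -wj.
- by apply: bigcup_measurable => i _; apply: measurableI.
Qed.

(** This replaces conditional expectation: a bound that holds conditionally on
    every value of a discrete variable holds unconditionally. *)
Lemma le_measure_fibers d (T : measurableType d) (R : realType)
    (mu : {measure set T -> \bar R}) (X : T -> nat) (A C : set T) (c : R) :
  (forall i, measurable (X @^-1` [set i])) ->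
  measurable A -> measurable C ->
  (forall i, mu (A `&` X @^-1` [set i])
             <= c%:E * mu (C `&` X @^-1` [set i]))%E ->
  (mu A <= c%:E * mu C)%E.
Proof.
move=> mX mA mC AC.
rewrite (measure_sum_fibers _ _ _ mu X A mX mA).
rewrite (measure_sum_fibers _ _ _ mu X C mX mC).
by rewrite -nneseriesZl //; exact: lee_nneseries.
Qed.

(** * Real-valued probabilities on the unit interval *)

Section real_probability.
Context {R : realType}.

Lemma EFin_Pr (A : set (Omega R)) : measurable A -> (Pr A)%:E = lebP A.
Proof. by move=> mA; rewrite fineK // fin_num_measure. Qed.

Lemma Pr_ge0 (A : set (Omega R)) : 0 <= Pr A.
Proof. by rewrite fine_ge0. Qed.

Lemma Pr_le1 (A : set (Omega R)) : measurable A -> Pr A <= 1.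
Proof. by move=> mA; rewrite -lee_fin EFin_Pr // probability_le1. Qed.

Lemma le_Pr (A C : set (Omega R)) : measurable A -> measurable C ->
  A `<=` C -> Pr A <= Pr C.
Proof. by move=> mA mC AC; rewrite -lee_fin !EFin_Pr // le_measure ?inE. Qed.

End real_probability.

(** * Events that depend on finitely many of the variables *)

Section oppenheim_theory.
Context {R : realType}.
Variables (F : cumulativeBounded (0 : R) (1 : R)) (phi : nat -> nat -> R).
Variables (q : forall n : nat, n.-tuple nat -> R).
Variable B : nat -> {RV (@lebP R) >-> nat}.

Lemma measurable_B n (S : set nat) : measurable (B n @^-1` S).
Proof. by rewrite -[X in measurable X]setTI; exact: measurable_funP. Qed.

Lemma measurable_history n h : measurable (history B n h).
Proof.
rewrite [X in measurable X](_ : _ =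
    \bigcap_(j in [set j | (1 <= j <= n)%N]) (B j @^-1` [set h j])); last first.
  by apply/seteqP; split => w /= + j; exact.
by apply: bigcap_measurableType => j _; exact: measurable_B.
Qed.

Definition history_code (n : nat) (w : Omega R) : nat :=
  pickle (prefix1 n (fun j => B j w)).

Lemma history_codeP n w w' :
  history_code n w' = history_code n w <-> history B n (fun j => B j w) w'.
Proof.
split=> [/(pcan_inj pickleK) E j /andP[j1 jn]|ww'].
  have jn' : (j.-1 < n)%N by rewrite prednK.
  by move/(congr1 (fun t => tnth t (Ordinal jn'))): E;
    rewrite !tnth_mktuple /= prednK.
by congr pickle; apply: eq_mktuple => i; apply: ww' => /=.
Qed.

Lemma measurable_history_code n i : measurable (history_code n @^-1` [set i]).
Proof.
have [->|/set0P[w /= <-]] := eqVneq (history_code n @^-1` [set i]) set0 => //.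
rewrite [X in measurable X](_ : _ = history B n (fun j => B j w)).
  exact: measurable_history.
by apply/seteqP; split => w' /history_codeP.
Qed.

(** The hypothesis says that A is saturated for the code of the first n
    variables, so A is a preimage of a set of codes. *)
Lemma measurable_determined n (A : set (Omega R)) :
  (forall w w', history B n (fun j => B j w) w' -> A w -> A w') ->
  measurable A.
Proof.
move=> detA; rewrite (_ : A = history_code n @^-1` (history_code n @` A)).
  by apply: measurable_preimage_nat; exact: measurable_history_code.
apply/seteqP; split => [w Aw|w [w' Aw' /esym/history_codeP /detA]]; last exact.
by exists w.
Qed.

(** R_n involves B_1, ..., B_{n+1}, hence the shift by one between indices of R
    and lengths of histories. *)
Lemma oppenheim_R_history n w w' : (0 < n)%N ->
  history B n.+1 (fun j => B j w) w' ->
  oppenheim_R phi q B n w' = oppenheim_R phi q B n w.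
Proof.
move=> n0 ww'; rewrite /oppenheim_R.
have -> : oppenheim_Q q B n w' = oppenheim_Q q B n w.
  by congr q; apply: eq_mktuple => i; apply: ww'; rewrite /= ltnS ltnW.
by rewrite !ww' ?n0 ?leqnn ?leqnSn.
Qed.

Lemma oppenheim_R_history_le n k w w' : (0 < k <= n)%N ->
  history B n.+1 (fun j => B j w) w' ->
  oppenheim_R phi q B k w' = oppenheim_R phi q B k w.
Proof.
move=> /andP[k0 kn] ww'; apply: oppenheim_R_history => // j /andP[j1 jk].
by apply: ww'; rewrite j1 (leq_trans jk).
Qed.

Lemma oppenheim_min_history n w w' : (0 < n)%N ->
  history B n.+1 (fun j => B j w) w' ->
  oppenheim_min phi q B n w' = oppenheim_min phi q B n w.
Proof.
move=> n0 ww'; rewrite /oppenheim_min (oppenheim_R_history_le n 1 w)//.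
by apply: eq_big_nat => k kn; apply: oppenheim_R_history_le ww'.
Qed.

Lemma oppenheim_max_history n w w' : (0 < n)%N ->
  history B n.+1 (fun j => B j w) w' ->
  oppenheim_max phi q B n w' = oppenheim_max phi q B n w.
Proof.
move=> n0 ww'; rewrite /oppenheim_max (oppenheim_R_history_le n 1 w)//.
by apply: eq_big_nat => k kn; apply: oppenheim_R_history_le ww'.
Qed.

Definition all_exceed (x : R) (n : nat) : set (Omega R) :=
  [set w | forall k, (0 < k <= n)%N -> x < oppenheim_R phi q B k w].

Lemma measurable_all_exceed x n : measurable (all_exceed x n).
Proof.
apply: (measurable_determined n.+1) => w w' ww' wx k kn.
by rewrite (oppenheim_R_history_le n k w)//; exact: wx.
Qed.

(** * The conditional law of the next variable *)

Hypothesis oppB : generalized_oppenheim F phi q B.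

Lemma oppenheim_phi_gt0 n w : (0 < n)%N -> 0 < phi n (B n w).
Proof.
move=> n0; apply: (lt_le_trans ltr01).
by apply: (oppenheim_phi_ge1 oppB) => //; exact: (oppenheim_B_gt0 oppB).
Qed.

Lemma oppenheim_Q_ge0 n w : (0 < n)%N -> 0 <= oppenheim_Q q B n w.
Proof.
move=> n0; apply: (oppenheim_q_ge0 oppB) => //.
apply/all_tnthP => i; rewrite tnth_mktuple.
exact: (oppenheim_B_gt0 oppB).
Qed.

Lemma oppenheim_R_inv_delta n w :
  oppenheim_R phi q B n w =
  (delta phi n (B n w) (B n.+1 w) (oppenheim_Q q B n w))^-1.
Proof. by rewrite /oppenheim_R /delta invf_div. Qed.

Lemma oppenheim_R_gt1 n w : (0 < n)%N -> 1 < oppenheim_R phi q B n w ->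
  phi n (B n w) <= (B n.+1 w)%:R.
Proof.
move=> n0; have p0 := oppenheim_phi_gt0 n w n0.
have Q0 := oppenheim_Q_ge0 n w n0.
have Q1 : 0 < 1 + oppenheim_Q q B n w by rewrite ltr_wpDr.
rewrite /oppenheim_R ltr_pdivlMr ?mulr_gt0// mul1r mulrDr mulr1 ltrD2r.
exact: ltW.
Qed.

(** R_j > 1 means B_{j+1} > phi_j(B_j), so exceeding a level x > 1 makes the
    history admissible up to the index n + 1. *)
Lemma admissible_all_exceed x n w : 1 < x ->
  all_exceed x n w -> admissible phi n.+1 (fun j => B j w).
Proof.
move=> x1 wx; split; first exact: (oppenheim_B_gt0 oppB).
case=> [//|[//|j]] /= jn.
by apply: oppenheim_R_gt1 => //; apply: (lt_trans x1); apply: wx.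
Qed.

(** Induction on m telescopes the law.  It starts at F(delta(1)) = 1, because
    phi >= 1 makes delta(1) >= 1, and because B is positive. *)
Lemma Pr_history_tail n w m : (0 < n)%N ->
  admissible phi n (fun j => B j w) ->
  Pr ([set v | (m.+1 <= B n.+1 v)%N] `&` history B n (fun j => B j w)) =
  F (delta phi n (B n w) m.+1 (oppenheim_Q q B n w)) *
  Pr (history B n (fun j => B j w)).
Proof.
move=> n0 adm; set H := history _ _ _; set Q := oppenheim_Q _ _ _ _.
have mH : measurable H by exact: measurable_history.
have mI (S : set nat) : measurable (B n.+1 @^-1` S `&` H).
  by apply: measurableI => //; exact: measurable_B.
elim: m => [|m IH].
  rewrite (oppenheim_F1 oppB) ?mul1r; last first.
    have p1 : 1 <= phi n (B n w).
      by apply: (oppenheim_phi_ge1 oppB) => //; exact: (oppenheim_B_gt0 oppB).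
    have Q0 : 0 <= Q by exact: oppenheim_Q_ge0.
    have p0 : 0 < phi n (B n w) by exact: lt_le_trans p1.
    have d0 : 0 < 1%:R + phi n (B n w) * Q.
      by rewrite ltr_wpDr ?mulr_ge0 ?(ltW p0).
    by rewrite /delta ler_pdivlMr// mul1r mulrDr mulr1 lerD2r.
  congr Pr; apply/seteqP; split => [v []//|v Hv]; split => //.
  exact: (oppenheim_B_gt0 oppB).
have atom : Pr ([set v | B n.+1 v = m.+1] `&` H) =
    (F (delta phi n (B n w) m.+1 Q) - F (delta phi n (B n w) m.+2 Q)) * Pr H.
  have [H0|H0] := eqVneq (Pr H) 0.
    rewrite H0 mulr0; apply/eqP; rewrite eq_le Pr_ge0 andbT -H0.
    by apply: le_Pr => //; exact: (mI [set m.+1]).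
  (* The history of w prolonged by the value m + 1 at time n + 1. *)
  pose h j := if (j <= n)%N then B j w else m.+1.
  have hB j : (j <= n)%N -> h j = B j w by move=> jn; rewrite /h jn.
  have hS : h n.+1 = m.+1 by rewrite /h ltnn.
  have EH : history B n h = H.
    by apply/seteqP; split => v vh j /andP[j0 jn]; rewrite vh ?j0// hB.
  have EQ : q n (prefix1 n h) = Q.
    by congr q; apply: eq_mktuple => i; rewrite hB.
  have := @oppenheim_law _ _ _ _ _ oppB n h n0.
  rewrite EH EQ hS (hB n)// => /(_ _ _ H0) <-.
  - by rewrite /condPr divfK.
  - move=> j /andP[j0 _]; rewrite /h; case: ifP => // _.
    exact: (oppenheim_B_gt0 oppB).
  - case: adm => B1 adm; split=> [|j /andP[j2 jn]]; first by rewrite hB.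
    by rewrite !hB ?(leq_trans (leq_pred j))//; apply: adm; rewrite j2.
have split_tail : Pr ([set v | (m.+1 <= B n.+1 v)%N] `&` H) =
    Pr ([set v | B n.+1 v = m.+1] `&` H)
    + Pr ([set v | (m.+2 <= B n.+1 v)%N] `&` H).
  apply: EFin_inj; rewrite EFinD !EFin_Pr;
    [|exact: (mI [set k | (m.+2 <= k)%N])|exact: (mI [set m.+1])
     |exact: (mI [set k | (m.+1 <= k)%N])].
  rewrite -measureU; [|exact: (mI [set m.+1])
    |exact: (mI [set k | (m.+2 <= k)%N])|].
    congr lebP; rewrite -setIUl; congr (_ `&` _).
    apply/seteqP; split => v /=.
      by rewrite leq_eqVlt => /orP[/eqP|]; [left|right].
    by case=> [->//|/ltnW].
  by apply/seteqP; split => // v [[/= -> _] [/=]]; rewrite ltnn.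
move: split_tail; rewrite IH atom => /eqP; rewrite addrC -subr_eq => /eqP <-.
by rewrite -mulrBl subKr.
Qed.

(** The values of B_{n+2} that make R_{n+1} exceed x are at least the least
    positive k with delta(k) < 1/x; the point w shows that such a k exists. *)
Lemma Pr_all_exceed_history x n w : 1 < x -> all_exceed x n.+1 w ->
  Pr (all_exceed x n.+1 `&` history B n.+1 (fun j => B j w)) <=
  F (x^-1) * Pr (history B n.+1 (fun j => B j w)).
Proof.
move=> x1 wx; set H := history _ _ _; set Q := oppenheim_Q q B n.+1 w.
have x0 : 0 < x by exact: lt_trans x1.
have adm : admissible phi n.+1 (fun j => B j w).
  apply: (admissible_all_exceed x) => // k /andP[k0 kn].
  by apply: wx; rewrite k0 leqW.
(* Positivity is required because delta at k = 0 is 0 when Q = 0. *)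
pose small k := (0 < k)%N && (delta phi n.+1 (B n.+1 w) k Q < x^-1).
have smallB v : all_exceed x n.+1 v -> H v -> small (B n.+2 v).
  move=> vx Hv; apply/andP; split; first exact: (oppenheim_B_gt0 oppB).
  have := vx n.+1; rewrite ltnSn => /(_ isT).
  rewrite oppenheim_R_inv_delta Hv ?ltnSn//.
  rewrite (_ : oppenheim_Q q B n.+1 v = Q); last first.
    by congr q; apply: eq_mktuple => i; apply: Hv => /=.
  move=> xd; rewrite -[ltLHS]invrK ltf_pV2 ?posrE//.
  exact: lt_trans xd.
have exsmall : exists k, small k by exists (B n.+2 w); exact: smallB.
case: (ex_minnP exsmall) => -[//|m] /andP[_ md] minm.
have mH : measurable H by exact: measurable_history.
apply: (@le_trans _ _ (Pr ([set v | (m.+1 <= B n.+2 v)%N] `&` H))).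
  apply: le_Pr.
  - by apply: measurableI => //; exact: measurable_all_exceed.
  - by apply: measurableI => //; exact: (measurable_B _ [set k | (m < k)%N]).
  - by move=> v [vx Hv]; split => //; apply: minm; exact: smallB.
rewrite Pr_history_tail// ler_wpM2r ?Pr_ge0//.
by apply: cumulative_is_nondecreasing; exact: ltW.
Qed.

(** * Geometric decay *)

Lemma oppenheim_F_ge0 t : 0 <= F t.
Proof.
have [t0|/ltW t0] := leP t 0; first by rewrite (oppenheim_F0 oppB).
have : F 0 <= F t by exact: cumulative_is_nondecreasing.
by have -> : F 0 = 0 by exact: (oppenheim_F0 oppB).
Qed.

Lemma Pr_all_exceedS x n : 1 < x ->
  Pr (all_exceed x n.+1) <= F (x^-1) * Pr (all_exceed x n).
Proof.
move=> x1; rewrite -lee_fin EFinM !EFin_Pr; try exact: measurable_all_exceed.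
have mE k := measurable_all_exceed x k.
apply: (le_measure_fibers _ _ _ _ (history_code n.+1)) => //.
  exact: measurable_history_code.
move=> i; set C := _ @^-1` _.
(* On a nonempty fiber, one of its points provides the history. *)
have [E0|/set0P[w [wx /= wi]]] := eqVneq (all_exceed x n.+1 `&` C) set0.
  by rewrite E0 measure0 mule_ge0// lee_fin oppenheim_F_ge0.
have -> : C = history B n.+1 (fun j => B j w).
  by rewrite /C -wi; apply/seteqP; split => v /history_codeP.
have wxn : all_exceed x n w.
  by move=> k /andP[k0 kn]; apply: wx; rewrite k0 leqW.
rewrite [X in (_ <= _ * lebP X)%E](_ : _ = history B n.+1 (fun j => B j w)).
  rewrite -!EFin_Pr -?EFinM ?lee_fin; [exact: Pr_all_exceed_history| | ];
  by try apply: measurableI => //; exact: measurable_history.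
apply/seteqP; split => [v []//|v Hv]; split => // k kn.
by rewrite (oppenheim_R_history_le n k w)//; exact: wxn.
Qed.

Lemma Pr_all_exceed_le x n : 1 < x -> Pr (all_exceed x n) <= F (x^-1) ^+ n.
Proof.
move=> x1; elim: n => [|n IH].
  by rewrite expr0 Pr_le1//; exact: measurable_all_exceed.
by rewrite exprS (le_trans (Pr_all_exceedS x n x1))// ler_wpM2l//
  oppenheim_F_ge0.
Qed.

Lemma min_all_exceed x n w : x < oppenheim_min phi q B n w -> all_exceed x n w.
Proof.
move=> xmin k kn; apply: (lt_le_trans xmin).
by apply: ge_bigmin_seq => //; rewrite mem_index_iota ltnS.
Qed.

End oppenheim_theory.

(** * The limit *)

Theorem corollary6 (R : realType) (F : cumulativeBounded (0 : R) (1 : R))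
    (phi : nat -> nat -> R) (q : forall n : nat, n.-tuple nat -> R)
    (B : nat -> {RV (@lebP R) >-> nat}) (x y : R) :
  generalized_oppenheim F phi q B ->
  1 < x -> x < y ->
  (exists2 beta : R, 0 < beta &
    forall s t : R, t <= s -> F s - F t <= beta * (s - t)) ->
  F (1 / x) < 1 / 2 ->
  (fun n : nat =>
     Pr [set w | x < oppenheim_min phi q B n w /\ oppenheim_max phi q B n w <= y]
     - Pr [set w | x < oppenheim_min phi q B n w]
       * Pr [set w | oppenheim_max phi q B n w <= y]) @ \oo --> (0 : R).
Proof.
move=> oppB x1 _ _ Fx.
rewrite div1r in Fx.
have F0 : 0 <= F x^-1 by exact: oppenheim_F_ge0 oppB _.
have Fpow : (fun n => F x^-1 ^+ n) @ \oo --> (0 : R).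
  apply: cvg_expr; rewrite ger0_norm//; apply: (lt_le_trans Fx).
  by rewrite ler_pdivrMr// mul1r ler1n.
have oFpow : (fun n => - (F x^-1 ^+ n)) @ \oo --> (0 : R).
  by rewrite -[X in _ --> X]oppr0; exact: cvgN.
apply: squeeze_cvgr oFpow Fpow; near=> n.
have n0 : (0 < n)%N by near: n; exact: nbhs_infty_gt.
set A := [set w | _ /\ _]; set Z := [set w | x < _]; set M := [set w | _ <= y].
have minE := oppenheim_min_history phi q B n.
have maxE := oppenheim_max_history phi q B n.
have mA : measurable A.
  apply: (measurable_determined B n.+1) => w w' ww'.
  by rewrite /A /= (minE w)// (maxE w).
have mZ : measurable Z.
  by apply: (measurable_determined B n.+1) => w w' ww'; rewrite /Z /= (minE w).
have mM : measurable M.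
  by apply: (measurable_determined B n.+1) => w w' ww'; rewrite /M /= (maxE w).
have AZ : Pr A <= Pr Z by apply: le_Pr => // w [].
have ZF : Pr Z <= F x^-1 ^+ n.
  apply: le_trans (Pr_all_exceed_le F phi q B oppB x n x1).
  by apply: le_Pr => //; [exact: measurable_all_exceed|exact: min_all_exceed].
have ZM0 : 0 <= Pr Z * Pr M by rewrite mulr_ge0 ?Pr_ge0.
have ZM1 : Pr Z * Pr M <= Pr Z by rewrite ler_piMr ?Pr_ge0 ?Pr_le1.
have A0 := Pr_ge0 A.
by apply/andP; split; lra.
Unshelve. all: by end_near. Qed.
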